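(* Let $T=3$ and suppose $\underline{C}\le\overline{V}<\underline{C}+V$, $\overline{C}-\overline{V}-V\ge 0$ and $\overline{C}-\underline{C}-2V<0$. (i) If $L=\ell=1$, then $\mathrm{conv}(P)$ is the set of all $(x_1,x_2,x_3,y_1,y_2,y_3,u_2,u_3)\in\mathbb{R}^8$ satisfying \begin{align*} & u_2\ge y_2-y_1,\quad u_3\ge y_3-y_2,\quad u_2\ge 0,\quad u_3\ge 0,\\ & x_1\ge\underline{C}y_1,\quad x_2\ge\underline{C}y_2,\quad x_3\ge\underline{C}y_3,\\ & u_2\le y_2,\quad u_3\le y_3,\quad y_1+u_2\le 1,\quad y_2+u_3\le 1,\\ & x_1\le\overline{V}y_1+(\overline{C}-\overline{V})(y_2-u_2),\\ & x_1\le\overline{V}y_1+V(y_2-u_2)+(\overline{C}-\overline{V}-V)(y_3-u_3),\\ & x_2\le\overline{C}y_2-(\overline{C}-\overline{V})u_2,\\ & x_2\le\overline{V}y_2+(\overline{C}-\overline{V})(y_3-u_3),\\ & x_3\le\overline{C}y_3-(\overline{C}-\overline{V})u_3,\\ & x_3\le(\overline{V}+V)y_3-Vu_3+(\overline{C}-\overline{V}-V)(y_2-u_2),\\ & x_2-x_1\le\overline{V}y_2-\underline{C}y_1+(\underline{C}+V-\overline{V})(y_3-u_3),\\ & x_2-x_1\le(\underline{C}+V)y_2-\underline{C}y_1-(\underline{C}+V-\overline{V})u_2,\\ & x_3-x_2\le(\underline{C}+V)y_3-\underline{C}y_2-(\underline{C}+V-\overline{V})u_3,\\ & x_1-x_2\le\overline{V}y_1-(\overline{V}-V)y_2-(\underline{C}+V-\overline{V})u_2,\\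 & x_2-x_3\le\overline{V}y_2-(\overline{V}-V)y_3-(\underline{C}+V-\overline{V})u_3,\\ & x_2-x_3\le(\underline{C}+V)y_2-\underline{C}y_3-(\underline{C}+V-\overline{V})u_2. \end{align*} (ii) If $L=\ell=2$, then $\mathrm{conv}(P)$ is the set of all $(x_1,x_2,x_3,y_1,y_2,y_3,u_2,u_3)\in\mathbb{R}^8$ satisfying \begin{align*} & u_2+u_3\le y_3,\qquad y_1+u_2+u_3\le 1,\\ & u_2\ge y_2-y_1,\quad u_3\ge y_3-y_2,\quad u_2\ge 0,\quad u_3\ge 0,\\ & x_1\ge\underline{C}y_1,\quad x_2\ge\underline{C}y_2,\quad x_3\ge\underline{C}y_3,\\ & x_1\le\overline{V}y_1+V(y_2-u_2)+(\overline{C}-\overline{V}-V)(y_3-u_3-u_2),\\ & x_2\le\overline{V}y_2+(\overline{C}-\overline{V})(y_3-u_3-u_2),\\ & x_3\le\overline{C}y_3-(\overline{C}-\overline{V})u_3-(\overline{C}-\overline{V}-V)u_2,\\ & x_2-x_1\le\overline{V}y_2-\underline{C}y_1+(\underline{C}+V-\overline{V})(y_3-u_3-u_2),\\ & x_3-x_2\le(\underline{C}+V)y_3-\underline{C}y_2-(\underline{C}+V-\overline{V})u_3,\\ & x_1-x_2\le\overline{V}y_1-(\overline{V}-V)y_2-(\underline{C}+V-\overline{V})u_2,\\ & x_2-x_3\le\overline{V}y_2-\underline{C}y_3+(\underline{C}+V-\overline{V})(y_3-u_3-u_2),\\ & x_1-x_2+x_3\le\overline{V}y_1-(\overline{V}-V)y_2+\overline{V}y_3+(\overline{C}-\overline{V})(y_3-u_3-u_2).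 \end{align*}
   Context: $T$ is the number of time periods, $L,\ell$ are positive integers (minimum-up and minimum-down time), and $\underline{C},\overline{C},\overline{V},V$ are real parameters (generation lower bound, generation upper bound, start-up/shut-down ramp rate, ramp rate in the stable region) with $0\le\underline{C}\le\overline{V}\le\overline{C}$ and $V>0$. For integers $a,b$, $[a,b]_{\mathbb{Z}}$ is the set of integers $i$ with $a\le i\le b$. $P$ is the set of $(x,y,u)\in\mathbb{R}_+^T\times\{0,1\}^T\times\{0,1\}^{T-1}$, with $x=(x_1,\dots,x_T)$, $y=(y_1,\dots,y_T)$, $u=(u_2,\dots,u_T)$, such that \begin{align*} &\textstyle\sum_{i=t-L+1}^{t}u_i\le y_t,\ t\in[L+1,T]_{\mathbb{Z}};\qquad \sum_{i=t-\ell+1}^{t}u_i\le 1-y_{t-\ell},\ t\in[\ell+1,T]_{\mathbb{Z}};\\ &y_t-y_{t-1}-u_t\le 0,\ t\in[2,T]_{\mathbb{Z}};\qquad \underline{C}y_t\le x_t\le\overline{C}y_t,\ t\in[1,T]_{\mathbb{Z}};\\ &x_t-x_{t-1}\le Vy_{t-1}+\overline{V}(1-y_{t-1}),\ t\in[2,T]_{\mathbb{Z}};\qquad x_{t-1}-x_t\le Vy_t+\overline{V}(1-y_t),\ t\in[2,T]_{\mathbb{Z}}. \end{align*} $\mathrm{conv}(P)$ denotes the convex hull of $P$. *)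

(* Defs.v *)
(* MathComp and MathComp-Analysis. *)
From HB Require Import structures.
From mathcomp Require Import all_boot all_order all_algebra.
From mathcomp Require Import boolp classical_sets reals convex.

Set Implicit Arguments.
Unset Strict Implicit.
Unset Printing Implicit Defensive.

Import Order.TTheory GRing.Theory Num.Theory.

Local Open Scope classical_set_scope.
Local Open Scope ring_scope.

Definition convex_hull (R : numDomainType) (M : lmodType R) (A : set M) :
    set M :=
  smallest (@convex_set R M) A.

(* A point of R^T x R^T x R^(T-1): the triple (x, y, u), where u has the
   components u_2, ..., u_T only. *)
Notation uc_point R T := ('rV[R]_T * 'rV[R]_T * 'rV[R]_T.-1)%type.

Definition entry (R : realType) (n : nat) (v : 'rV[R]_n) (k : nat) : R :=
  if insub k is Some i then v ord0 i else 0.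

(* The mathematical indices are t = 1, ..., T for x and y and t = 2, ..., T for
   u, hence the shifts; values at other t are junk and never used. *)
Definition xc (R : realType) (T : nat) (z : uc_point R T) (t : nat) : R :=
  entry z.1.1 (t - 1).

Definition yc (R : realType) (T : nat) (z : uc_point R T) (t : nat) : R :=
  entry z.1.2 (t - 1).

Definition uc (R : realType) (T : nat) (z : uc_point R T) (t : nat) : R :=
  entry z.2 (t - 2).

(* Cmin, Cmax: generation bounds; Vbar: start-up/shut-down ramp rate; V: ramp
   rate in the stable region; L, l: minimum-up and minimum-down times. The
   truncated subtractions are exact on the ranges of t for L, l >= 1. *)
Definition uc_set (R : realType) (T L l : nat) (Cmin Cmax Vbar V : R) :
    set (uc_point R T) :=
  [set z | let x := xc z in let y := yc z in let u := uc z in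
    (forall t, (1 <= t <= T)%N -> 0 <= x t) /\
    (forall t, (1 <= t <= T)%N -> y t = 0 \/ y t = 1) /\
    (forall t, (2 <= t <= T)%N -> u t = 0 \/ u t = 1) /\
    (forall t, (L + 1 <= t <= T)%N ->
      \sum_(t - L + 1 <= i < t.+1) u i <= y t) /\
    (forall t, (l + 1 <= t <= T)%N ->
      \sum_(t - l + 1 <= i < t.+1) u i <= 1 - y (t - l)%N) /\
    (forall t, (2 <= t <= T)%N -> y t - y (t - 1)%N - u t <= 0) /\
    (forall t, (1 <= t <= T)%N -> Cmin * y t <= x t <= Cmax * y t) /\
    (forall t, (2 <= t <= T)%N ->
      x t - x (t - 1)%N <= V * y (t - 1)%N + Vbar * (1 - y (t - 1)%N)) /\
    (forall t, (2 <= t <= T)%N ->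
      x (t - 1)%N - x t <= V * y t + Vbar * (1 - y t))].

Arguments uc_set {R} T L l Cmin Cmax Vbar V.

(* Main.v *)
(* Write a point as a convex combination of on/off patterns y in {0,1}^3, each
   of which determines u, and give every pattern a share of x. The shares exist
   iff a system of difference constraints in them is feasible; in it the first
   and third periods interact only through the second one. Eliminating the
   shares leaves linear inequalities in x and the pattern weights. For L = l = 2
   the weights are determined by (y, u). For L = l = 1 the weight of 111 and the
   coupling of 10* with *01 remain free; taking the weight of 111 as large as
   possible, min (y2 - u2, y3 - u3), turns the inequalities into the facets. *)
Require Import Defs.
From HB Require Import structures.
From mathcomp Require Import all_boot all_order all_algebra.
From mathcomp Require Import boolp classical_sets reals convex.
From mathcomp Require Import interval_inference lra ring.

Set Implicit Arguments.
Unset Strict Implicit.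
Unset Printing Implicit Defensive.

Import Order.TTheory GRing.Theory Num.Theory.

Local Open Scope classical_set_scope.
Local Open Scope ring_scope.

(** * Splitting a level into shares with prescribed bounds *)

Lemma split2_itv (R : realFieldType) (l1 h1 l2 h2 x : R) :
  l1 <= h1 -> l2 <= h2 -> l1 + l2 <= x <= h1 + h2 ->
  exists a b : R, [/\ x = a + b, l1 <= a <= h1 & l2 <= b <= h2].
Proof.
move=> lh1 lh2 /andP[lx xh].
have [xle|xge] := leP x (l1 + h2).
  by exists l1, (x - l1); split; [ring | lra | lra].
by exists (x - h2), h2; split; [ring | lra | lra].
Qed.

Lemma split3_itv (R : realFieldType) (l1 h1 l2 h2 l3 h3 x : R) :
  l1 <= h1 -> l2 <= h2 -> l3 <= h3 -> l1 + l2 + l3 <= x <= h1 + h2 + h3 ->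
  exists a b d : R,
    [/\ x = a + b + d, l1 <= a <= h1, l2 <= b <= h2 & l3 <= d <= h3].
Proof.
move=> lh1 lh2 lh3 xb.
have [||e [d [-> eb db]]] := @split2_itv _ (l1 + l2) (h1 + h2) l3 h3 x _ _ xb.
- by lra.
- by [].
have [a [b [-> ab bb]]] := split2_itv lh1 lh2 eb.
by exists a, b, d.
Qed.

(** Elimination of one variable: the largest lower bound serves as [z]. For explicit lists the
    hypothesis computes to one comparison per pair of bounds, ready for [lra]. *)
Lemma exists_between (R : realFieldType) (l : R) (ls us : seq R) :
  all (fun x => all (fun y => x <= y) us) (l :: ls) ->
  exists z, all (fun x => x <= z) (l :: ls) && all (fun y => z <= y) us.
Proof.
elim: ls => [|l' ls IH] /=.
  by exists l; rewrite lexx andTb -[X in is_true X]andbT.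
case/and3P => lu l'u lsu.
have [|z /andP[/= /andP[lz lsz] uz]] := IH; first by rewrite /= lu.
exists (Num.max z l'); rewrite /= !le_max lz lexx orbT /=; apply/andP; split.
  by apply: sub_all lsz => w wz; rewrite le_max wz.
by apply/allP => w wu; rewrite ge_max (allP uz) ?(allP l'u).
Qed.

(* Once the share [z] of the middle period is fixed, the first and the last
   period decouple: this lemma treats either of them. *)
Lemma split_tracking (R : realFieldType) (A B C D x z : R) :
  0 <= A -> 0 <= B -> 0 <= D -> 0 <= z <= C -> 0 <= x -> z - D <= x ->
  x <= A + B + C -> x <= A + B + z + D ->
  exists a b d : R, [/\ x = a + b + d, 0 <= a <= A, 0 <= b <= B &
                        0 <= d <= C /\ `|d - z| <= D].
Proof.
move=> A0 B0 D0 /andP[z0 zC] x0 zx xC xz.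
(* The admissible [d] form $[0,C]\cap[z-D,z+D]$, nonempty because it contains [z]. *)
pose l := Num.max 0 (z - D); pose h := Num.min C (z + D).
have [lx hx lh] : [/\ l <= x, x - A - B <= h & l <= h].
  by rewrite /l /h !ge_max !le_min; split; do ?[apply/andP; split]; lra.
have /andP[l0 lD] : (0 <= l) && (z - D <= l) by rewrite -ge_max.
have /andP[hC hD] : (h <= C) && (h <= z + D) by rewrite -le_min.
clearbody l h.
have [|a [b [d [-> ab bb db]]]] := @split3_itv _ 0 A 0 B l h x A0 B0 lh.
  by apply/andP; split; lra.
case/andP: db => ld dh.
exists a, b, d; split=> //; split; first by apply/andP; split; lra.
by rewrite ler_norml; apply/andP; split; lra.
Qed.

(** [S] and [T] are the effective lower bounds of [s] and [t]. Since [S + T] is a maximum of nine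
    sums, [S + T <= x] amounts to nine of the hypotheses. *)
Lemma split_middle (R : realFieldType) (A B C m m' n n' x : R) :
  0 <= A -> 0 <= B -> 0 <= C -> m <= A -> m' <= A -> n <= B -> n' <= B ->
  0 <= x -> m <= x -> m' <= x -> n <= x -> n' <= x ->
  m + n <= x -> m + n' <= x -> m' + n <= x -> m' + n' <= x ->
  x <= A + B + C ->
  exists s t w : R, [/\ x = s + t + w,
    [/\ 0 <= s <= A, m <= s & m' <= s],
    [/\ 0 <= t <= B, n <= t & n' <= t] & 0 <= w <= C].
Proof.
move=> A0 B0 C0 mA mA' nB nB' x0 mx mx' nx nx' p1 p2 p3 p4 xABC.
pose S := Num.max 0 (Num.max m m'); pose T := Num.max 0 (Num.max n n').
have SA : S <= A by rewrite !ge_max A0 mA mA'.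
have TB : T <= B by rewrite !ge_max B0 nB nB'.
have ST : S + T <= x.
  rewrite -lerBrDr !ge_max.
  by do ?[apply/andP; split]; rewrite lerBrDr -lerBrDl !ge_max;
     do ?[apply/andP; split]; lra.
have [|s [t [w [-> /andP[Ss sA] /andP[Tt tB] wb]]]] :=
  @split3_itv _ S A T B 0 C x SA TB C0.
  by apply/andP; split; lra.
move: Ss Tt; rewrite !ge_max => /and3P[? ? ?] /and3P[? ? ?].
by exists s, t, w; split=> //; split=> //; apply/andP.
Qed.

(* [z], [s], [t], [w] are the shares of x2 carried by the patterns 111, 110,
   011, 010; [a1], [b1], [d1] those of x1 carried by 10*, 110, 111; [a3], [b3],
   [d3] those of x3 carried by *01, 011, 111. The constants are the capacities
   of these shares: start-up (A to E) and ramp rate (F, H, I) times a weight;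
   J is the generation capacity of 111. The lists of bounds on [z] come from
   eliminating all other shares. *)
Lemma disaggregation (R : realFieldType)
    (A B C D E F H I J x1 x2 x3 : R) :
  0 <= A -> 0 <= B -> 0 <= C -> 0 <= D -> 0 <= E -> 0 <= F -> 0 <= H ->
  0 <= I -> I <= J -> J <= 2 * I -> 0 <= x1 -> 0 <= x2 -> 0 <= x3 ->
  x1 <= D + A + F + J -> x3 <= E + B + H + J -> x2 <= A + B + C + J ->
  x2 - x1 <= A + B + C + I -> x2 - x3 <= A + B + C + I ->
  x1 - x2 <= D + F + I -> x3 - x2 <= E + H + I ->
  x1 - x2 + x3 <= D + E + F + H + I + J ->
  exists s t w z a1 b1 d1 a3 b3 d3 : R,
    [/\ [/\ x1 = a1 + b1 + d1, x2 = s + t + w + z & x3 = a3 + b3 + d3],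
        [/\ 0 <= s <= A, 0 <= t <= B, 0 <= w <= C & 0 <= z <= J],
        [/\ 0 <= a1 <= D, 0 <= b1 <= s + F & 0 <= d1 <= J /\ `|d1 - z| <= I] &
        [/\ 0 <= a3 <= E, 0 <= b3 <= t + H & 0 <= d3 <= J /\ `|d3 - z| <= I]].
Proof.
move=> A0 B0 C0 D0 E0 F0 H0 I0 IJ J2I x10 x20 x30 h1 h3 h2 h21 h23 h12 h32 h123.
(* To cover [x1], the share [s] must be at least [m - d], as [d1 <= J], and at least [m - z], as
   [d1 <= z + I]; likewise [t] with [n] to cover [x3]. *)
pose m := x1 - D - F - I; pose n := x3 - E - H - I; pose d := J - I.
have [z /andP[/= /and5P[z1 z2 z3 z4 /andP[z5 _]]
    /and5P[zJ zx1 zx3 zx2 /and4P[zm zn zmn _]]]] :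
    exists z,
      all (fun x => x <= z)
        [:: 0; x2 - (A + B + C); m - A; n - B; m + n - x2] &&
    all (fun y => z <= y) [:: J; x1 + I; x3 + I; x2; x2 - m + d; x2 - n + d;
                   x2 - m - n + 2 * d].
  apply: exists_between.
  have [m1 m2 mA] : [/\ m <= x1, m <= x2 & m - A <= d].
    by rewrite /m /d; split; lra.
  have [n3 n2 nB] : [/\ n <= x3, n <= x2 & n - B <= d].
    by rewrite /n /d; split; lra.
  (* The bounds [m - d] on [s] and [n - z] on [t] together require $m+n-d\le x_2$, where [z]
     cancels: this is [h123]. *)
  have mnd : m + n - x2 <= d by rewrite /m /n /d; lra.
  (* [d <= I] restates [J <= 2 * I]; it places [m - A] below [x3 + I] and [n - B] below [x1 + I]. *)
  have [dI dJ d0] : [/\ d <= I, d <= J & 0 <= d] by rewrite /d; split; lra.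
  clearbody m n d.
  clear - A0 B0 C0 I0 x10 x20 x30 h2 h21 h23 m1 m2 mA n3 n2 nB mnd dI dJ d0.
  by rewrite /= !andbT; do ?[apply/andP; split]; lra.
have [||||||||||||||s [t [w [xE [sA ms m's] [tB nt n't] wC]]]] :=
  @split_middle _ A B C (m - d) (m - z) (n - d) (n - z) (x2 - z) A0 B0 C0;
  [rewrite /m /n /d in zm zn zmn z3 z4 z5 *; lra.. | ].
have zb : 0 <= z <= J by apply/andP.
have [/andP[s0 _] /andP[t0 _]] := (sA, tB).
have sF : 0 <= s + F by exact: addr_ge0.
have tH : 0 <= t + H by exact: addr_ge0.
rewrite /m /n /d in ms m's nt n't.
have [|||a1 [b1 [d1 [e1 a1b b1b d1b]]]] :=
    @split_tracking _ D (s + F) J I x1 z D0 sF I0 zb x10.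
- by lra.
- by lra.
- by lra.
have [|||a3 [b3 [d3 [e3 a3b b3b d3b]]]] :=
    @split_tracking _ E (t + H) J I x3 z E0 tH I0 zb x30.
- by lra.
- by lra.
- by lra.
exists s, t, w, z, a1, b1, d1, a3, b3, d3; split=> //; split=> //.
by rewrite -xE subrK.
Qed.

(** * Convex sets and their homogenization *)

Lemma convex_hull_convex (R : numDomainType) (M : lmodType R) (A : set M) :
  convex_set (convex_hull A : set (convex_lmodType M)).
Proof.
move=> x y t /set_mem hx /set_mem hy; apply/mem_set => B [Bc AB].
by apply/set_mem/Bc; apply/mem_set; [apply: hx | apply: hy].
Qed.

Lemma convex_setE (R : realType) (M : lmodType R) (A : set M) :
  convex_set (A : set (convex_lmodType M)) <->
  (forall (x y : M) (t : R),
    0 <= t <= 1 -> A x -> A y -> A (t *: x + (1 - t) *: y)).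
Proof.
split=> [cA x y t t01 Ax Ay|cA x y t /set_mem Ax /set_mem Ay].
  have := cA x y (Itv01 (proj1 (andP t01)) (proj2 (andP t01))).
  by move=> /(_ (mem_set Ax) (mem_set Ay)) /set_mem.
by apply/mem_set/(cA x y t%:num) => //; apply/andP; split.
Qed.

(** The pairs $(w,z)$ of the cone generated by $\{1\}\times A$. Convex combinations can then be
    built by successive additions, without normalizing partial weights. *)
Definition cone (R : realType) (M : lmodType R) (A : set M) (w : R) (z : M) :=
  0 <= w /\ exists2 p, A p & z = w *: p.

(** The sum is [w1 + w2] times the convex combination of [p1] and [p2] with coefficient
    $w_1/(w_1+w_2)$; if the total weight is 0, both terms vanish. *)
Lemma coneD (R : realType) (M : lmodType R) (A : set M) (w1 w2 : R) (z1 z2 : M) :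
  convex_set (A : set (convex_lmodType M)) ->
  cone A w1 z1 -> cone A w2 z2 -> cone A (w1 + w2) (z1 + z2).
Proof.
move=> /convex_setE cA [w10 [p1 Ap1 ->]] [w20 [p2 Ap2 ->]].
split; first exact: addr_ge0.
have [w0|w_neq0] := eqVneq (w1 + w2) 0.
  have [-> ->] : w1 = 0 /\ w2 = 0 by split; lra.
  by exists p1 => //; rewrite addr0 !scale0r addr0.
have w_gt0 : 0 < w1 + w2 by rewrite lt0r w_neq0 addr_ge0.
exists (w1 / (w1 + w2) *: p1 + (1 - w1 / (w1 + w2)) *: p2).
  apply: cA => //; apply/andP; split; first by rewrite divr_ge0 // ltW.
  by rewrite ler_pdivrMr // mul1r; lra.
rewrite scalerDr !scalerA; congr (_ *: _ + _ *: _); field => //.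
Qed.

(** * Three-period points and their constraints in coordinates *)

Definition uc_mk (R : realType) (x1 x2 x3 y1 y2 y3 u2 u3 : R) : uc_point R 3 :=
  (\row_k nth 0 [:: x1; x2; x3] k, \row_k nth 0 [:: y1; y2; y3] k,
   \row_k nth 0 [:: u2; u3] k).

Lemma entry_row (R : realType) (n : nat) (f : nat -> R) (k : nat) :
  (k < n)%N -> entry (\row_(i < n) f i) k = f k.
Proof. by move=> kn; rewrite /entry insubT mxE. Qed.

Lemma uc_mk_coord (R : realType) (x1 x2 x3 y1 y2 y3 u2 u3 : R) :
  let z := uc_mk x1 x2 x3 y1 y2 y3 u2 u3 in
  ((xc z 1 = x1) * (xc z 2 = x2) * (xc z 3 = x3)) *
  ((yc z 1 = y1) * (yc z 2 = y2) * (yc z 3 = y3)) *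
  ((uc z 2 = u2) * (uc z 3 = u3)).
Proof. by move=> z; rewrite /xc /yc /uc !entry_row. Qed.

Lemma uc_mkE (R : realType) (z : uc_point R 3) :
  z = uc_mk (xc z 1) (xc z 2) (xc z 3) (yc z 1) (yc z 2) (yc z 3)
            (uc z 2) (uc z 3).
Proof.
have e (n : nat) (v : 'rV[R]_n) (i : 'I_n) : v ord0 i = entry v i.
  by rewrite /entry valK.
case: z => [[x y] u]; rewrite /uc_mk /xc /yc /uc /=; congr (_, _, _).
- by apply/rowP; case=> [[|[|[|//]]] i3]; rewrite mxE e.
- by apply/rowP; case=> [[|[|[|//]]] i3]; rewrite mxE e.
- by apply/rowP; case=> [[|[|//]] i2]; rewrite mxE e.
Qed.

Lemma uc_mkD (R : realType) (x1 x2 x3 y1 y2 y3 u2 u3 a1 a2 a3 b1 b2 b3 d2 d3 : R) :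
  uc_mk x1 x2 x3 y1 y2 y3 u2 u3 + uc_mk a1 a2 a3 b1 b2 b3 d2 d3 =
  uc_mk (x1 + a1) (x2 + a2) (x3 + a3) (y1 + b1) (y2 + b2) (y3 + b3)
        (u2 + d2) (u3 + d3).
Proof.
congr (_, _, _); apply/rowP.
- by case=> [[|[|[|//]]] i3]; rewrite !mxE.
- by case=> [[|[|[|//]]] i3]; rewrite !mxE.
- by case=> [[|[|//]] i2]; rewrite !mxE.
Qed.

Lemma uc_mkZ (R : realType) (t x1 x2 x3 y1 y2 y3 u2 u3 : R) :
  t *: uc_mk x1 x2 x3 y1 y2 y3 u2 u3 =
  uc_mk (t * x1) (t * x2) (t * x3) (t * y1) (t * y2) (t * y3)
        (t * u2) (t * u3).
Proof.
congr (_, _, _); apply/rowP.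
- by case=> [[|[|[|//]]] i3]; rewrite !mxE.
- by case=> [[|[|[|//]]] i3]; rewrite !mxE.
- by case=> [[|[|//]] i2]; rewrite !mxE.
Qed.

(* Homogenized constraints on the generation levels: [w] replaces the constant 1,
   so they describe a point of weight [w]. *)
Definition dispatch (R : realType) (Cmin Cmax Vbar V w y1 y2 y3 x1 x2 x3 : R) :=
  [/\ [/\ Cmin * y1 <= x1 <= Cmax * y1, Cmin * y2 <= x2 <= Cmax * y2 &
          Cmin * y3 <= x3 <= Cmax * y3],
      x2 - x1 <= V * y1 + Vbar * (w - y1),
      x3 - x2 <= V * y2 + Vbar * (w - y2),
      x1 - x2 <= V * y2 + Vbar * (w - y2) &
      x2 - x3 <= V * y3 + Vbar * (w - y3)].

(** The converse recovers $x_t\ge 0$ from [Cmin * y <= x] with [0 <= Cmin]. The minimum-up and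
    minimum-down sums stay quantified, as their range depends on [L] and [l]. *)
Lemma uc_set3_common (R : realType) (L l : nat) (Cmin Cmax Vbar V : R)
    (z : uc_point R 3) :
  0 <= Cmin ->
  uc_set 3 L l Cmin Cmax Vbar V z <->
  [/\ [/\ yc z 1 = 0 \/ yc z 1 = 1, yc z 2 = 0 \/ yc z 2 = 1 &
          yc z 3 = 0 \/ yc z 3 = 1],
      (uc z 2 = 0 \/ uc z 2 = 1) /\ (uc z 3 = 0 \/ uc z 3 = 1),
      yc z 2 - yc z 1 <= uc z 2 /\ yc z 3 - yc z 2 <= uc z 3,
      (forall t, (L + 1 <= t <= 3)%N ->
        \sum_(t - L + 1 <= i < t.+1) uc z i <= yc z t) /\
      (forall t, (l + 1 <= t <= 3)%N ->
        \sum_(t - l + 1 <= i < t.+1) uc z i <= 1 - yc z (t - l)%N) &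
      dispatch Cmin Cmax Vbar V 1 (yc z 1) (yc z 2) (yc z 3)
        (xc z 1) (xc z 2) (xc z 3)].
Proof.
move=> C0; split.
- case=> _ [hy [hu [hL [hl [hs [hb [hr hd]]]]]]].
  have := hs 2%N isT; have := hs 3%N isT; rewrite !subr_le0 => s3 s2.
  split=> //; first by split; apply: hy.
    by split; apply: hu.
  split; first by split; apply: hb.
  - exact: (hr 2%N).
  - exact: (hr 3%N).
  - exact: (hd 2%N).
  - exact: (hd 3%N).
- case=> -[y1 y2 y3] [u2 u3] [s2 s3] [hL hl] [[b1 b2 b3] r2 r3 d2 d3].
  have x0 (x y : R) : (y = 0 \/ y = 1) -> Cmin * y <= x <= Cmax * y -> 0 <= x.
    by move=> y01 /andP[+ _]; apply: le_trans; case: y01 => ->; rewrite ?mulr0 ?mulr1.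
  split; first by case=> [|[|[|[|t]]]] // _;
    [exact: x0 y1 b1 | exact: x0 y2 b2 | exact: x0 y3 b3].
  split; first by case=> [|[|[|[|t]]]] // _.
  split; first by case=> [|[|[|[|t]]]] // _.
  split=> //; split=> //.
  split; first by case=> [|[|[|[|t]]]] // _; rewrite subr_le0.
  split; first by case=> [|[|[|[|t]]]] // _.
  by split; case=> [|[|[|[|t]]]] // _.
Qed.

Lemma uc_set3_11 (R : realType) (Cmin Cmax Vbar V : R) (z : uc_point R 3) :
  0 <= Cmin ->
  uc_set 3 1 1 Cmin Cmax Vbar V z <->
  [/\ [/\ yc z 1 = 0 \/ yc z 1 = 1, yc z 2 = 0 \/ yc z 2 = 1 &
          yc z 3 = 0 \/ yc z 3 = 1],
      (uc z 2 = 0 \/ uc z 2 = 1) /\ (uc z 3 = 0 \/ uc z 3 = 1),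
      yc z 2 - yc z 1 <= uc z 2 /\ yc z 3 - yc z 2 <= uc z 3,
      [/\ uc z 2 <= yc z 2, uc z 3 <= yc z 3, uc z 2 <= 1 - yc z 1 &
          uc z 3 <= 1 - yc z 2] &
      dispatch Cmin Cmax Vbar V 1 (yc z 1) (yc z 2) (yc z 3)
        (xc z 1) (xc z 2) (xc z 3)].
Proof.
move=> C0; rewrite uc_set3_common //.
have sum1 t : (0 < t)%N -> \sum_(t - 1 + 1 <= i < t.+1) uc z i = uc z t.
  by move=> t0; rewrite subnK // big_nat1.
split=> -[hy hu hs hL hd]; split=> //.
  case: hL => hL hl.
  have := hL 2%N isT; have := hL 3%N isT; have := hl 2%N isT; have := hl 3%N isT.
  by rewrite !sum1.
by case: hL => ? ? ? ?; split; case=> [|[|[|[|t]]]] // _; rewrite sum1.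
Qed.

(** Only [t = 3] is in range of the minimum-time constraints; both sums are then $u_2+u_3$, and
    $y_{t-\ell}$ is $y_1$. *)
Lemma uc_set3_22 (R : realType) (Cmin Cmax Vbar V : R) (z : uc_point R 3) :
  0 <= Cmin ->
  uc_set 3 2 2 Cmin Cmax Vbar V z <->
  [/\ [/\ yc z 1 = 0 \/ yc z 1 = 1, yc z 2 = 0 \/ yc z 2 = 1 &
          yc z 3 = 0 \/ yc z 3 = 1],
      (uc z 2 = 0 \/ uc z 2 = 1) /\ (uc z 3 = 0 \/ uc z 3 = 1),
      yc z 2 - yc z 1 <= uc z 2 /\ yc z 3 - yc z 2 <= uc z 3,
      uc z 2 + uc z 3 <= yc z 3 /\ uc z 2 + uc z 3 <= 1 - yc z 1 &
      dispatch Cmin Cmax Vbar V 1 (yc z 1) (yc z 2) (yc z 3)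
        (xc z 1) (xc z 2) (xc z 3)].
Proof.
move=> C0; rewrite uc_set3_common //.
have sum2 : \sum_(3 - 2 + 1 <= i < 4) uc z i = uc z 2 + uc z 3.
  by rewrite (_ : 3 - 2 + 1 = 2)%N // big_ltn // big_nat1.
split=> -[hy hu hs hL hd]; split=> //.
  case: hL => hL hl; have := hL 3%N isT; have := hl 3%N isT.
  by rewrite !sum2.
by case: hL => ? ?; split; case=> [|[|[|[|t]]]] // _; rewrite sum2.
Qed.

Lemma dispatchZ (R : realType) (Cmin Cmax Vbar V t w y1 y2 y3 x1 x2 x3 : R) :
  0 <= t -> dispatch Cmin Cmax Vbar V w y1 y2 y3 x1 x2 x3 ->
  dispatch Cmin Cmax Vbar V (t * w) (t * y1) (t * y2) (t * y3)
    (t * x1) (t * x2) (t * x3).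
Proof.
move=> t0 [[/andP[b1 b1'] /andP[b2 b2'] /andP[b3 b3']] r2 r3 d2 d3].
have sc (a b : R) : a <= b -> t * a <= t * b by exact: ler_wpM2l.
split; first by split; apply/andP; split; rewrite mulrCA; apply: sc.
- by move/sc: r2; clear; lra.
- by move/sc: r3; clear; lra.
- by move/sc: d2; clear; lra.
- by move/sc: d3; clear; lra.
Qed.

(** * Assembling a point from weighted on/off patterns *)

(** The last two coordinates are the start-up indicators of the pattern, the only values of $u$ that
    the constraints of $P$ can allow. *)
Definition contains_pattern (R : realType) (Cmin Cmax Vbar V : R)
    (A : set (uc_point R 3)) (b1 b2 b3 : bool) :=
  forall x1 x2 x3 : R,
    dispatch Cmin Cmax Vbar V 1 b1%:R b2%:R b3%:R x1 x2 x3 ->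
    A (uc_mk x1 x2 x3 b1%:R b2%:R b3%:R (~~ b1 && b2)%:R (~~ b2 && b3)%:R).

(** For positive [w], dividing by [w] gives a point of the pattern. For [w = 0] the generation
    bounds force all levels to 0, so a pattern absent from [A] may still occur with weight 0. *)
Lemma cone_pattern (R : realType) (Cmin Cmax Vbar V w x1 x2 x3 : R)
    (b1 b2 b3 : bool) (A : set (uc_point R 3)) :
  w = 0 \/ contains_pattern Cmin Cmax Vbar V A b1 b2 b3 ->
  A !=set0 -> 0 <= w ->
  dispatch Cmin Cmax Vbar V w (w * b1%:R) (w * b2%:R) (w * b3%:R) x1 x2 x3 ->
  cone A w (uc_mk x1 x2 x3 (w * b1%:R) (w * b2%:R) (w * b3%:R)
                  (w * (~~ b1 && b2)%:R) (w * (~~ b2 && b3)%:R)).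
Proof.
move=> hA [p Ap] w0 hx; split=> //.
have [w0'|w_neq0] := eqVneq w 0.
  exists p => //; move: hx; rewrite w0' !mul0r scale0r.
  case=> -[]; rewrite !mulr0 -!eq_le => /eqP <- /eqP <- /eqP <- _ _ _ _.
  by rewrite -(scale0r (uc_mk 0 0 0 0 0 0 0 0)) uc_mkZ !mul0r.
case: hA => [/eqP|hA]; first by rewrite (negPf w_neq0).
exists (w^-1 *: uc_mk x1 x2 x3 (w * b1%:R) (w * b2%:R) (w * b3%:R)
                  (w * (~~ b1 && b2)%:R) (w * (~~ b2 && b3)%:R)).
  rewrite uc_mkZ !mulKf //; apply: hA.
  have w_inv0 : 0 <= w^-1 by rewrite invr_ge0.
  by have := dispatchZ w_inv0 hx; rewrite !mulKf // mulVf.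
by rewrite scalerA mulfV // scale1r.
Qed.

(* [al], [be], [ga], [lam], [pi] are the weights of the patterns y = 110, 011,
   010, 111, 101, while [q] and [r] are the total weights of 10* and *01. The
   generation levels are shifted by their lower bounds Cmin * y. *)
Lemma point_of_weights (R : realType) (Cmin c v V : R)
    (al be ga lam q r pi x1 x2 x3 : R) (A : set (uc_point R 3)) :
  let P := contains_pattern Cmin (Cmin + c) (Cmin + v) V A in
  0 <= Cmin -> 0 <= v -> v < V -> v + V <= c -> c < 2 * V ->
  convex_set (A : set (convex_lmodType (uc_point R 3))) ->
  P true true true -> P true true false -> P false true true ->
  P true false false -> P false false true -> P false false false ->
  ga = 0 \/ P false true false -> pi = 0 \/ P true false true ->
  0 <= al -> 0 <= be -> 0 <= ga -> 0 <= lam -> 0 <= pi -> pi <= q -> pi <= r ->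
  al + be + ga + lam + q + r - pi <= 1 ->
  0 <= x1 -> 0 <= x2 -> 0 <= x3 ->
  x1 <= v * q + v * al + V * al + c * lam ->
  x3 <= v * r + v * be + V * be + c * lam ->
  x2 <= v * al + v * be + v * ga + c * lam ->
  x2 - x1 <= v * al + v * be + v * ga + V * lam ->
  x2 - x3 <= v * al + v * be + v * ga + V * lam ->
  x1 - x2 <= v * q + V * al + V * lam ->
  x3 - x2 <= v * r + V * be + V * lam ->
  x1 - x2 + x3 <= v * q + v * r + V * al + V * be + V * lam + c * lam ->
  A (uc_mk (x1 + Cmin * (q + al + lam)) (x2 + Cmin * (al + be + ga + lam))
           (x3 + Cmin * (r + be + lam))
           (q + al + lam) (al + be + ga + lam) (r + be + lam) (be + ga) r).
Proof.
move=> P C0 v0 vV vVc c2V cA P111 P110 P011 P100 P001 P000 P010 P101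
  al0 be0 ga0 lam0 pi0 piq pir sum_le1 x10 x20 x30 h1 h3 h2 h21 h23 h12 h32 h123.
have V0 : 0 <= V by lra.
have c0 : 0 <= c by lra.
have [q0 r0] : 0 <= q /\ 0 <= r by split; lra.
(* These are [I <= J] and [J <= 2 * I] of [disaggregation], for the ramp and generation capacities
   of 111. *)
have Il : V * lam <= c * lam by apply: ler_wpM2r => //; lra.
have Jl : c * lam <= 2 * (V * lam) by rewrite mulrA; apply: ler_wpM2r => //; lra.
have [s [t [w [z [a1 [b1 [d1 [a3 [b3 [d3 [[-> -> ->] [sb tb wb zb]
    [a1b b1b [d1b d1z]] [a3b b3b [d3b d3z]]]]]]]]]]]]] :=
  disaggregation (mulr_ge0 v0 al0) (mulr_ge0 v0 be0) (mulr_ge0 v0 ga0)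
    (mulr_ge0 v0 q0) (mulr_ge0 v0 r0) (mulr_ge0 V0 al0) (mulr_ge0 V0 be0)
    (mulr_ge0 V0 lam0) Il Jl x10 x20 x30 h1 h3 h2 h21 h23 h12 h32 h123.
clear h1 h3 h2 h21 h23 h12 h32 h123 x10 x20 x30.
(* The share of 10* is divided between 100 and 101, that of *01 between 001 and 101. With the middle
   period off, each level is limited only by its own start-up capacity, so the two divisions are
   independent. *)
have split_a (a p : R) : 0 <= a <= v * p -> pi <= p ->
    exists a' a'' : R, [/\ a = a' + a'', 0 <= a' <= v * (p - pi) & 0 <= a'' <= v * pi].
  move=> ab pip; apply: split2_itv.
  - by rewrite mulr_ge0 // subr_ge0.
  - by rewrite mulr_ge0.
  - by rewrite addr0 -mulrDr subrK.
have [a1' [a1'' [-> a1'b a1''b]]] := split_a a1 q a1b piq.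
have [a3' [a3'' [-> a3'b a3''b]]] := split_a a3 r a3b pir.
have A_nonempty : A !=set0.
  exists (uc_mk 0 0 0 false%:R false%:R false%:R false%:R false%:R).
  apply: P000; rewrite /dispatch /=; split; first by rewrite !mulr0 lexx.
  - by rewrite mulr0 !subr0 add0r mulr1 addr_ge0.
  - by rewrite mulr0 !subr0 add0r mulr1 addr_ge0.
  - by rewrite mulr0 !subr0 add0r mulr1 addr_ge0.
  - by rewrite mulr0 !subr0 add0r mulr1 addr_ge0.
move: d1z d3z; rewrite !ler_norml => d1z d3z.
(* In 110, [s <= v * al <= V * al] gives the ramp-up limit, and [b1 <= s + V * al <= c * al] the
   generation limit; 011 is symmetric. *)
have bounds w' : 0 <= w' -> [/\ 0 <= v * w', 0 <= Cmin * w',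
    v * w' <= V * w' & v * w' + V * w' <= c * w'].
  by move=> w0; rewrite !mulr_ge0 // -mulrDl !ler_wpM2r // ltW.
have c111 : cone A lam (uc_mk (d1 + Cmin * lam) (z + Cmin * lam)
    (d3 + Cmin * lam) lam lam lam 0 0).
  have := cone_pattern (or_intror P111) A_nonempty lam0.
  rewrite /= !mulr1 !mulr0; apply; rewrite /dispatch.
  have [f1 f2 f3 f4] := bounds _ lam0; clear - f1 f2 f3 f4 zb d1b d1z d3b d3z.
  by split; [split; lra | lra | lra | lra | lra].
have c110 : cone A al (uc_mk (b1 + Cmin * al) (s + Cmin * al) 0 al al 0 0 0).
  have := cone_pattern (or_intror P110) A_nonempty al0.
  rewrite /= !mulr1 !mulr0; apply; rewrite /dispatch.
  have [f1 f2 f3 f4] := bounds _ al0; clear - f1 f2 f3 f4 sb b1b.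
  by split; [split; lra | lra | lra | lra | lra].
have c011 : cone A be (uc_mk 0 (t + Cmin * be) (b3 + Cmin * be) 0 be be be 0).
  have := cone_pattern (or_intror P011) A_nonempty be0.
  rewrite /= !mulr1 !mulr0; apply; rewrite /dispatch.
  have [f1 f2 f3 f4] := bounds _ be0; clear - f1 f2 f3 f4 tb b3b.
  by split; [split; lra | lra | lra | lra | lra].
have c010 : cone A ga (uc_mk 0 (w + Cmin * ga) 0 0 ga 0 ga 0).
  have := cone_pattern P010 A_nonempty ga0.
  rewrite /= !mulr1 !mulr0; apply; rewrite /dispatch.
  have [f1 f2 f3 f4] := bounds _ ga0; clear - f1 f2 f3 f4 wb.
  by split; [split; lra | lra | lra | lra | lra].
have qpi0 : 0 <= q - pi by rewrite subr_ge0.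
have c100 : cone A (q - pi) (uc_mk (a1' + Cmin * (q - pi)) 0 0 (q - pi) 0 0 0 0).
  have := cone_pattern (or_intror P100) A_nonempty qpi0.
  rewrite /= !mulr1 !mulr0; apply; rewrite /dispatch.
  have := bounds _ qpi0; move: (q - pi) a1'b => w' a1'b [f1 f2 f3 f4].
  clear - f1 f2 f3 f4 a1'b.
  by split; [split; lra | lra | lra | lra | lra].
have c101 : cone A pi (uc_mk (a1'' + Cmin * pi) 0 (a3'' + Cmin * pi) pi 0 pi 0 pi).
  have := cone_pattern P101 A_nonempty pi0.
  rewrite /= !mulr1 !mulr0; apply; rewrite /dispatch.
  have [f1 f2 f3 f4] := bounds _ pi0; clear - f1 f2 f3 f4 a1''b a3''b.
  by split; [split; lra | lra | lra | lra | lra].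
have rpi0 : 0 <= r - pi by rewrite subr_ge0.
have c001 : cone A (r - pi) (uc_mk 0 0 (a3' + Cmin * (r - pi)) 0 0 (r - pi) 0 (r - pi)).
  have := cone_pattern (or_intror P001) A_nonempty rpi0.
  rewrite /= !mulr1 !mulr0; apply; rewrite /dispatch.
  have := bounds _ rpi0; move: (r - pi) a3'b => w' a3'b [f1 f2 f3 f4].
  clear - f1 f2 f3 f4 a3'b.
  by split; [split; lra | lra | lra | lra | lra].
have o0 : 0 <= 1 - (al + be + ga + lam + q + r - pi) by rewrite subr_ge0.
have c000 : cone A (1 - (al + be + ga + lam + q + r - pi)) (uc_mk 0 0 0 0 0 0 0 0).
  have := cone_pattern (or_intror P000) A_nonempty o0.
  rewrite /= !mulr0; apply; rewrite /dispatch.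
  have := bounds _ o0; move: (1 - _) o0 => w' o0 [f1 f2 f3 f4].
  clear - f1 f2 f3 f4 o0.
  by split; [split; lra | lra | lra | lra | lra].
(* The eight weights add up to 1, so the point [p] of [A] obtained here is the sum itself. *)
have := coneD cA c000 (coneD cA c001 (coneD cA c101 (coneD cA c100 (coneD cA c010
  (coneD cA c011 (coneD cA c110 c111)))))).
rewrite !uc_mkD => -[_ [p Ap e]].
suff -> : uc_mk (a1' + a1'' + b1 + d1 + Cmin * (q + al + lam))
  (s + t + w + z + Cmin * (al + be + ga + lam))
  (a3' + a3'' + b3 + d3 + Cmin * (r + be + lam)) (q + al + lam)
  (al + be + ga + lam) (r + be + lam) (be + ga) r = p by [].
rewrite -[p]scale1r.
transitivity ((1 - (al + be + ga + lam + q + r - pi) + (r - pi + (pi +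
  (q - pi + (ga + (be + (al + lam))))))) *: p); last first.
  by congr (_ *: _); ring.
by rewrite -e; congr uc_mk; ring.
Qed.

(** * The two inequality systems *)

Lemma convex_hull_eq (R : numDomainType) (M : lmodType R) (A B : set M) :
  convex_set (B : set (convex_lmodType M)) -> A `<=` B ->
  (forall K : set M, convex_set (K : set (convex_lmodType M)) -> A `<=` K ->
    B `<=` K) ->
  convex_hull A = B.
Proof.
move=> cB AB BK; apply/seteqP; split; first exact: smallest_sub.
by apply: BK; [exact: convex_hull_convex | exact: sub_gen_smallest].
Qed.

Definition facets11 (R : realType) (Cmin Cmax Vbar V x1 x2 x3 y1 y2 y3 u2 u3 : R) :=
      u2 >= y2 - y1 /\ u3 >= y3 - y2 /\ u2 >= 0 /\ u3 >= 0 /\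
      x1 >= Cmin * y1 /\ x2 >= Cmin * y2 /\ x3 >= Cmin * y3 /\
      u2 <= y2 /\ u3 <= y3 /\ y1 + u2 <= 1 /\ y2 + u3 <= 1 /\
      x1 <= Vbar * y1 + (Cmax - Vbar) * (y2 - u2) /\
      x1 <= Vbar * y1 + V * (y2 - u2) + (Cmax - Vbar - V) * (y3 - u3) /\
      x2 <= Cmax * y2 - (Cmax - Vbar) * u2 /\
      x2 <= Vbar * y2 + (Cmax - Vbar) * (y3 - u3) /\
      x3 <= Cmax * y3 - (Cmax - Vbar) * u3 /\
      x3 <= (Vbar + V) * y3 - V * u3 + (Cmax - Vbar - V) * (y2 - u2) /\
      x2 - x1 <= Vbar * y2 - Cmin * y1 + (Cmin + V - Vbar) * (y3 - u3) /\
      x2 - x1 <= (Cmin + V) * y2 - Cmin * y1 - (Cmin + V - Vbar) * u2 /\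
      x3 - x2 <= (Cmin + V) * y3 - Cmin * y2 - (Cmin + V - Vbar) * u3 /\
      x1 - x2 <= Vbar * y1 - (Vbar - V) * y2 - (Cmin + V - Vbar) * u2 /\
      x2 - x3 <= Vbar * y2 - (Vbar - V) * y3 - (Cmin + V - Vbar) * u3 /\
      x2 - x3 <= (Cmin + V) * y2 - Cmin * y3 - (Cmin + V - Vbar) * u2.

Definition facets22 (R : realType) (Cmin Cmax Vbar V x1 x2 x3 y1 y2 y3 u2 u3 : R) :=
      u2 + u3 <= y3 /\ y1 + u2 + u3 <= 1 /\
      u2 >= y2 - y1 /\ u3 >= y3 - y2 /\ u2 >= 0 /\ u3 >= 0 /\
      x1 >= Cmin * y1 /\ x2 >= Cmin * y2 /\ x3 >= Cmin * y3 /\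
      x1 <= Vbar * y1 + V * (y2 - u2) + (Cmax - Vbar - V) * (y3 - u3 - u2) /\
      x2 <= Vbar * y2 + (Cmax - Vbar) * (y3 - u3 - u2) /\
      x3 <= Cmax * y3 - (Cmax - Vbar) * u3 - (Cmax - Vbar - V) * u2 /\
      x2 - x1 <= Vbar * y2 - Cmin * y1
                 + (Cmin + V - Vbar) * (y3 - u3 - u2) /\
      x3 - x2 <= (Cmin + V) * y3 - Cmin * y2 - (Cmin + V - Vbar) * u3 /\
      x1 - x2 <= Vbar * y1 - (Vbar - V) * y2 - (Cmin + V - Vbar) * u2 /\
      x2 - x3 <= Vbar * y2 - Cmin * y3
                 + (Cmin + V - Vbar) * (y3 - u3 - u2) /\
      x1 - x2 + x3 <= Vbar * y1 - (Vbar - V) * y2 + Vbar * y3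
                      + (Cmax - Vbar) * (y3 - u3 - u2).

Definition on_coords (R : realType)
    (F : R -> R -> R -> R -> R -> R -> R -> R -> Prop) :
    set (uc_point R 3) :=
  [set z | F (xc z 1) (xc z 2) (xc z 3) (yc z 1) (yc z 2) (yc z 3) (uc z 2) (uc z 3)].

(** A linear inequality passes to a convex combination by scaling its two instances by $t$ and $1-t$
    and adding them; [lra] then matches monomials. *)
Ltac mix_ineq t0 s0 hx hy :=
  move: (lerD (ler_wpM2l t0 hx) (ler_wpM2l s0 hy)); clear; lra.

Ltac mix_ineqs t0 s0 hx hy :=
  let h := fresh "h" in let k := fresh "k" in
  lazymatch goal with
  | |- _ /\ _ => case: hx => h hx; case: hy => k hy;
                 split; [mix_ineq t0 s0 h k | mix_ineqs t0 s0 hx hy]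
  | _ => mix_ineq t0 s0 hx hy
  end.

Lemma convex_on_coords (R : realType)
    (F : R -> R -> R -> R -> R -> R -> R -> R -> Prop) :
  (forall t x1 x2 x3 y1 y2 y3 u2 u3 a1 a2 a3 b1 b2 b3 d2 d3 : R,
    let mix a b := t * a + (1 - t) * b in
    0 <= t -> 0 <= 1 - t ->
    F x1 x2 x3 y1 y2 y3 u2 u3 -> F a1 a2 a3 b1 b2 b3 d2 d3 ->
    F (mix x1 a1) (mix x2 a2) (mix x3 a3) (mix y1 b1) (mix y2 b2) (mix y3 b3)
      (mix u2 d2) (mix u3 d3)) ->
  convex_set (on_coords F : set (convex_lmodType (uc_point R 3))).
Proof.
move=> mixF; apply/convex_setE => x y t /andP[t0 t1] Fx Fy.
rewrite (uc_mkE x) (uc_mkE y) !uc_mkZ uc_mkD /on_coords /= !uc_mk_coord.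
by apply: mixF; rewrite ?subr_ge0.
Qed.

Lemma convex_facets11 (R : realType) (Cmin Cmax Vbar V : R) :
  convex_set (on_coords (facets11 Cmin Cmax Vbar V) :
    set (convex_lmodType (uc_point R 3))).
Proof.
apply: convex_on_coords => t x1 x2 x3 y1 y2 y3 u2 u3 a1 a2 a3 b1 b2 b3 d2 d3.
move=> /= t0 s0 hx hy; rewrite /facets11; mix_ineqs t0 s0 hx hy.
Qed.

Lemma convex_facets22 (R : realType) (Cmin Cmax Vbar V : R) :
  convex_set (on_coords (facets22 Cmin Cmax Vbar V) :
    set (convex_lmodType (uc_point R 3))).
Proof.
apply: convex_on_coords => t x1 x2 x3 y1 y2 y3 u2 u3 a1 a2 a3 b1 b2 b3 d2 d3.
move=> /= t0 s0 hx hy; rewrite /facets22; mix_ineqs t0 s0 hx hy.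
Qed.

Lemma facets11_sub (R : realType) (Cmin Cmax Vbar V : R)
    (Cmin_ge0 : 0 <= Cmin) (Cmin_le_Vbar : Cmin <= Vbar)
    (Vbar_lt : Vbar < Cmin + V) (Cmax_ge : 0 <= Cmax - Vbar - V)
    (Cmax_lt : Cmax - Cmin - 2 * V < 0) (K : set (uc_point R 3)) :
  convex_set (K : set (convex_lmodType (uc_point R 3))) ->
  uc_set 3 1 1 Cmin Cmax Vbar V `<=` K ->
  on_coords (facets11 Cmin Cmax Vbar V) `<=` K.
Proof.
move=> cK subK.
have P b1 b2 b3 : contains_pattern Cmin Cmax Vbar V K b1 b2 b3.
  move=> a1 a2 a3 ad; apply/subK/uc_set3_11; rewrite // !uc_mk_coord; split=> //.
  - by case: b1 b2 b3 {ad} => [] [] [] /=; split; by [left | right].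
  - by case: b1 b2 b3 {ad} => [] [] [] /=; split; by [left | right].
  - by case: b1 b2 b3 {ad} => [] [] [] /=; split; lra.
  - by case: b1 b2 b3 {ad} => [] [] [] /=; split; lra.
move=> z; rewrite (uc_mkE z) /on_coords /= !uc_mk_coord.
move: (xc z 1) (xc z 2) (xc z 3) (yc z 1) (yc z 2) (yc z 3) (uc z 2) (uc z 3).
move=> x1 x2 x3 y1 y2 y3 u2 u3.
case=> e1 [e2 [e3 [e4 [e5 [e6 [e7 [e8 [e9 [e10 [e11 [e12 [e13 [e14 [e15 [e16
  [e17 [e18 [e19 [e20 [e21 [e22 e23]]]]]]]]]]]]]]]]]]]]].
(* Every lower bound on the weight of 111 left by the elimination of the shares
   becomes easier to satisfy as this weight grows, so take it maximal. *)
pose lam := Num.min (y2 - u2) (y3 - u3).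
(* The least weight of 101 for which all weights fit into 1: 10* and *01 have weights
   $y_1-(y_2-u_2)$ and $u_3$, and share the weight $1-y_2$ of the patterns with the middle period
   off. *)
pose pi := Num.max 0 (y1 - (y2 - u2) + u3 - (1 - y2)).
have [pi0 pi1 piq pir] : [/\ 0 <= pi, y1 - (y2 - u2) + u3 - (1 - y2) <= pi,
    pi <= y1 - (y2 - u2) & pi <= u3].
  rewrite /pi !ge_max !le_max !lexx !orbT; clear - e1 e4 e10 e11.
  by split=> //; apply/andP; split; lra.
have vE : Cmin + (Vbar - Cmin) = Vbar by ring.
have cE : Cmin + (Cmax - Cmin) = Cmax by ring.
have lamP : lam <= y2 - u2 /\ lam <= y3 - u3 /\ (lam = y2 - u2 \/ lam = y3 - u3).
  rewrite /lam !ge_min !lexx orbT; do 2 split=> //.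
  by case: lerP => _; [left | right].
clearbody pi lam.
(* The totals $y_2-u_2$ of 11*, $y_3-u_3$ of *11 and $u_2$ of 01* fix the weights of 110, 011 and
   010 once [lam] is chosen. *)
have := @point_of_weights R Cmin (Cmax - Cmin) (Vbar - Cmin) V
  (y2 - u2 - lam) (y3 - u3 - lam) (u2 - (y3 - u3 - lam)) lam (y1 - (y2 - u2)) u3 pi
  (x1 - Cmin * y1) (x2 - Cmin * y2) (x3 - Cmin * y3) K.
rewrite vE cE /= => point_of_weights.
have -> : uc_mk x1 x2 x3 y1 y2 y3 u2 u3 =
  uc_mk (x1 - Cmin * y1 + Cmin * (y1 - (y2 - u2) + (y2 - u2 - lam) + lam))
    (x2 - Cmin * y2 + Cmin * (y2 - u2 - lam + (y3 - u3 - lam) +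
               (u2 - (y3 - u3 - lam)) + lam))
    (x3 - Cmin * y3 + Cmin * (u3 + (y3 - u3 - lam) + lam))
    (y1 - (y2 - u2) + (y2 - u2 - lam) + lam)
    (y2 - u2 - lam + (y3 - u3 - lam) + (u2 - (y3 - u3 - lam)) + lam)
    (u3 + (y3 - u3 - lam) + lam) (y3 - u3 - lam + (u2 - (y3 - u3 - lam))) u3.
  by congr uc_mk; ring.
apply: point_of_weights => //; try exact: P; try by right; exact: P.
(* Upper bounds with equal left sides in [facets11] are the instances of one condition at the two
   values of [lam]. The bound on $x_1-x_2+x_3$ is a sum of two others, since 110 or 011 has weight
   0. *)
all: case: lamP => [l1 [l2 [lE|lE]]]; rewrite ?lE in l1 l2 *.
all: lra.
Qed.

(** With 010 and 101 excluded, 011 has weight $u_2$ and *01 weight $u_3$, which determines the rest.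
    The eight upper bounds on levels required by [point_of_weights] are then exactly those of
    [facets22]. *)
Lemma facets22_sub (R : realType) (Cmin Cmax Vbar V : R)
    (Cmin_ge0 : 0 <= Cmin) (Cmin_le_Vbar : Cmin <= Vbar)
    (Vbar_lt : Vbar < Cmin + V) (Cmax_ge : 0 <= Cmax - Vbar - V)
    (Cmax_lt : Cmax - Cmin - 2 * V < 0) (K : set (uc_point R 3)) :
  convex_set (K : set (convex_lmodType (uc_point R 3))) ->
  uc_set 3 2 2 Cmin Cmax Vbar V `<=` K ->
  on_coords (facets22 Cmin Cmax Vbar V) `<=` K.
Proof.
move=> cK subK.
(* Of the eight patterns, 010 violates the minimum-up time and 101 the minimum-down time. *)
have P b1 b2 b3 : ~~ (~~ b1 && b2 && ~~ b3) && ~~ (b1 && ~~ b2 && b3) ->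
    contains_pattern Cmin Cmax Vbar V K b1 b2 b3.
  move=> b a1 a2 a3 ad; apply/subK/uc_set3_22; rewrite // !uc_mk_coord; split=> //.
  - by case: b1 b2 b3 {ad b} => [] [] [] /=; split; by [left | right].
  - by case: b1 b2 b3 {ad b} => [] [] [] /=; split; by [left | right].
  - by case: b1 b2 b3 {ad b} => [] [] [] /=; split; lra.
  - by case: b1 b2 b3 {ad} b => [] [] [] //= _; split; lra.
move=> z; rewrite (uc_mkE z) /on_coords /= !uc_mk_coord.
move: (xc z 1) (xc z 2) (xc z 3) (yc z 1) (yc z 2) (yc z 3) (uc z 2) (uc z 3).
move=> x1 x2 x3 y1 y2 y3 u2 u3.
case=> e1 [e2 [e3 [e4 [e5 [e6 [e7 [e8 [e9 [e10 [e11 [e12 [e13 [e14 [e15 [e16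
  e17]]]]]]]]]]]]]]].
have vE : Cmin + (Vbar - Cmin) = Vbar by ring.
have cE : Cmin + (Cmax - Cmin) = Cmax by ring.
have := @point_of_weights R Cmin (Cmax - Cmin) (Vbar - Cmin) V
  (y2 - u2 - (y3 - u3 - u2)) u2 0 (y3 - u3 - u2) (y1 - (y2 - u2)) u3 0
  (x1 - Cmin * y1) (x2 - Cmin * y2) (x3 - Cmin * y3) K.
rewrite vE cE /= => point_of_weights.
have -> : uc_mk x1 x2 x3 y1 y2 y3 u2 u3 =
  uc_mk (x1 - Cmin * y1 + Cmin * (y1 - (y2 - u2) + (y2 - u2 - (y3 - u3 - u2)) +
                                  (y3 - u3 - u2)))
    (x2 - Cmin * y2 + Cmin * (y2 - u2 - (y3 - u3 - u2) + u2 + 0 + (y3 - u3 - u2)))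
    (x3 - Cmin * y3 + Cmin * (u3 + u2 + (y3 - u3 - u2)))
    (y1 - (y2 - u2) + (y2 - u2 - (y3 - u3 - u2)) + (y3 - u3 - u2))
    (y2 - u2 - (y3 - u3 - u2) + u2 + 0 + (y3 - u3 - u2))
    (u3 + u2 + (y3 - u3 - u2)) (u2 + 0) u3.
  by congr uc_mk; ring.
by apply: point_of_weights => //; try exact: P; try (by left); lra.
Qed.

Ltac ineqs := lazymatch goal with
  | |- _ /\ _ => split; [lra | ineqs]
  | _ => lra
  end.

(** By convexity only binary $(y,u)$ need checking: each $y$ leaves one feasible $u$, and the facets
    become linear inequalities in $x$ and the parameters. *)
Lemma facets11_valid (R : realType) (Cmin Cmax Vbar V : R)
    (Cmin_ge0 : 0 <= Cmin) (Cmin_le_Vbar : Cmin <= Vbar)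
    (V_gt0 : 0 < V) (Vbar_lt : Vbar < Cmin + V)
    (Cmax_ge : 0 <= Cmax - Vbar - V) (Cmax_lt : Cmax - Cmin - 2 * V < 0) :
  uc_set 3 1 1 Cmin Cmax Vbar V `<=` on_coords (facets11 Cmin Cmax Vbar V).
Proof.
move=> z /uc_set3_11 -/(_ Cmin_ge0); rewrite /on_coords /= /facets11 /dispatch.
move: (xc z 1) (xc z 2) (xc z 3) (yc z 1) (yc z 2) (yc z 3) (uc z 2) (uc z 3).
move=> x1 x2 x3 y1 y2 y3 u2 u3 [hy hu [s2 s3] [l1 l2 l3 l4]
  [[b1 b2 b3] r2 r3 d2 d3]].
case: hy b1 b2 b3 r2 r3 d2 d3 s2 s3 l1 l2 l3 l4 => -[] -> [] -> [] ->.
all: case: hu => -[] -> [] -> b1 b2 b3 r2 r3 d2 d3 s2 s3 l1 l2 l3 l4.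
all: try by exfalso; clear - s2 s3 l1 l2 l3 l4; lra.
all: clear - Cmin_ge0 Cmin_le_Vbar V_gt0 Vbar_lt Cmax_ge Cmax_lt
             b1 b2 b3 r2 r3 d2 d3.
all: ineqs.
Qed.

Lemma facets22_valid (R : realType) (Cmin Cmax Vbar V : R)
    (Cmin_ge0 : 0 <= Cmin) (Cmin_le_Vbar : Cmin <= Vbar)
    (V_gt0 : 0 < V) (Vbar_lt : Vbar < Cmin + V)
    (Cmax_ge : 0 <= Cmax - Vbar - V) (Cmax_lt : Cmax - Cmin - 2 * V < 0) :
  uc_set 3 2 2 Cmin Cmax Vbar V `<=` on_coords (facets22 Cmin Cmax Vbar V).
Proof.
move=> z /uc_set3_22 -/(_ Cmin_ge0); rewrite /on_coords /= /facets22 /dispatch.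
move: (xc z 1) (xc z 2) (xc z 3) (yc z 1) (yc z 2) (yc z 3) (uc z 2) (uc z 3).
move=> x1 x2 x3 y1 y2 y3 u2 u3 [hy hu [s2 s3] [l1 l2] [[b1 b2 b3] r2 r3 d2 d3]].
case: hy b1 b2 b3 r2 r3 d2 d3 s2 s3 l1 l2 => -[] -> [] -> [] ->.
all: case: hu => -[] -> [] -> b1 b2 b3 r2 r3 d2 d3 s2 s3 l1 l2.
all: try by exfalso; clear - s2 s3 l1 l2; lra.
all: clear - Cmin_ge0 Cmin_le_Vbar V_gt0 Vbar_lt Cmax_ge Cmax_lt b1 b2 b3 r2 r3 d2 d3.
all: ineqs.
Qed.

Theorem theorem5 (R : realType) (Cmin Cmax Vbar V : R)
    (Cmin_ge0 : 0 <= Cmin) (Cmin_le_Vbar : Cmin <= Vbar)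
    (Vbar_le_Cmax : Vbar <= Cmax) (V_gt0 : 0 < V)
    (Vbar_lt : Vbar < Cmin + V)
    (Cmax_ge : 0 <= Cmax - Vbar - V)
    (Cmax_lt : Cmax - Cmin - 2 * V < 0) :
  convex_hull (uc_set 3 1 1 Cmin Cmax Vbar V) =
    [set z : uc_point R 3 |
      let x1 := xc z 1 in let x2 := xc z 2 in let x3 := xc z 3 in
      let y1 := yc z 1 in let y2 := yc z 2 in let y3 := yc z 3 in
      let u2 := uc z 2 in let u3 := uc z 3 in
      u2 >= y2 - y1 /\ u3 >= y3 - y2 /\ u2 >= 0 /\ u3 >= 0 /\
      x1 >= Cmin * y1 /\ x2 >= Cmin * y2 /\ x3 >= Cmin * y3 /\
      u2 <= y2 /\ u3 <= y3 /\ y1 + u2 <= 1 /\ y2 + u3 <= 1 /\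
      x1 <= Vbar * y1 + (Cmax - Vbar) * (y2 - u2) /\
      x1 <= Vbar * y1 + V * (y2 - u2) + (Cmax - Vbar - V) * (y3 - u3) /\
      x2 <= Cmax * y2 - (Cmax - Vbar) * u2 /\
      x2 <= Vbar * y2 + (Cmax - Vbar) * (y3 - u3) /\
      x3 <= Cmax * y3 - (Cmax - Vbar) * u3 /\
      x3 <= (Vbar + V) * y3 - V * u3 + (Cmax - Vbar - V) * (y2 - u2) /\
      x2 - x1 <= Vbar * y2 - Cmin * y1 + (Cmin + V - Vbar) * (y3 - u3) /\
      x2 - x1 <= (Cmin + V) * y2 - Cmin * y1 - (Cmin + V - Vbar) * u2 /\
      x3 - x2 <= (Cmin + V) * y3 - Cmin * y2 - (Cmin + V - Vbar) * u3 /\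
      x1 - x2 <= Vbar * y1 - (Vbar - V) * y2 - (Cmin + V - Vbar) * u2 /\
      x2 - x3 <= Vbar * y2 - (Vbar - V) * y3 - (Cmin + V - Vbar) * u3 /\
      x2 - x3 <= (Cmin + V) * y2 - Cmin * y3 - (Cmin + V - Vbar) * u2]
  /\
  convex_hull (uc_set 3 2 2 Cmin Cmax Vbar V) =
    [set z : uc_point R 3 |
      let x1 := xc z 1 in let x2 := xc z 2 in let x3 := xc z 3 in
      let y1 := yc z 1 in let y2 := yc z 2 in let y3 := yc z 3 in
      let u2 := uc z 2 in let u3 := uc z 3 in
      u2 + u3 <= y3 /\ y1 + u2 + u3 <= 1 /\
      u2 >= y2 - y1 /\ u3 >= y3 - y2 /\ u2 >= 0 /\ u3 >= 0 /\
      x1 >= Cmin * y1 /\ x2 >= Cmin * y2 /\ x3 >= Cmin * y3 /\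
      x1 <= Vbar * y1 + V * (y2 - u2) + (Cmax - Vbar - V) * (y3 - u3 - u2) /\
      x2 <= Vbar * y2 + (Cmax - Vbar) * (y3 - u3 - u2) /\
      x3 <= Cmax * y3 - (Cmax - Vbar) * u3 - (Cmax - Vbar - V) * u2 /\
      x2 - x1 <= Vbar * y2 - Cmin * y1
                 + (Cmin + V - Vbar) * (y3 - u3 - u2) /\
      x3 - x2 <= (Cmin + V) * y3 - Cmin * y2 - (Cmin + V - Vbar) * u3 /\
      x1 - x2 <= Vbar * y1 - (Vbar - V) * y2 - (Cmin + V - Vbar) * u2 /\
      x2 - x3 <= Vbar * y2 - Cmin * y3
                 + (Cmin + V - Vbar) * (y3 - u3 - u2) /\
      x1 - x2 + x3 <= Vbar * y1 - (Vbar - V) * y2 + Vbar * y3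
                      + (Cmax - Vbar) * (y3 - u3 - u2)].
Proof.
split.
  (* The set in the statement is [on_coords] of the facets up to unfolding. *)
  apply: (convex_hull_eq (B := on_coords (facets11 Cmin Cmax Vbar V))).
  - exact: convex_facets11.
  - exact: facets11_valid.
  - exact: facets11_sub.
apply: (convex_hull_eq (B := on_coords (facets22 Cmin Cmax Vbar V))).
- exact: convex_facets22.
- exact: facets22_valid.
- exact: facets22_sub.
Qed.
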